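(* Let $d\ge1$ and let $G$ be a graph that is rigid and totally loose in $\mathbb{R}^d$. Then $G$ can be obtained from $d$-special graphs by a sequence of clique sum operations.
   Context: A $d$-dimensional framework is a pair $(G,p)$ with $G=(V,E)$ a graph and $p:V\to\mathbb{R}^d$; it is generic if its $d|V|$ coordinates are algebraically independent over $\mathbb{Q}$. Frameworks $(G,p),(G,q)$ are equivalent if $\|p(u)-p(v)\|=\|q(u)-q(v)\|$ for all $uv\in E$, and congruent if this holds for all $u,v\in V$. $(G,p)$ is rigid if there is $\varepsilon>0$ such that every equivalent $(G,q)$ with $\|p(v)-q(v)\|<\varepsilon$ for all $v$ is congruent to $(G,p)$, and globally rigid if every equivalent $d$-dimensional framework is congruent to it. A graph is rigid (resp. globally rigid) in $\mathbb{R}^d$ if some (equivalently, every) generic realization in $\mathbb{R}^d$ is rigid (resp. globally rigid). A vertex pair $\{u,v\}$ is weakly globally linked in $G$ in $\mathbb{R}^d$ if there is a generic realization $(G,p)$ in $\mathbb{R}^d$ such that every equivalent $d$-dimensional $(G,q)$ satisfies $\|q(u)-q(v)\|=\|p(u)-p(v)\|$; otherwise it is globally loose. $G$ is totally loose in $\mathbb{R}^d$ if every non-adjacent pair is globally loose in $G$. A graph $G$ is $d$-special if it is rigid in $\mathbb{R}^d$ and every proper induced subgraph of $G$ that is rigid in $\mathbb{R}^d$ is complete. For graphs $G_1,G_2$ containing cliques $K_1\subseteq G_1$, $K_2\subseteq G_2$ on $t\ge1$ vertices, the ($t$-)clique sum along $K_1,K_2$ identifies the vertices of $K_1$ with those of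 $K_2$ via a bijection. *)

(* Defs.v *)
From HB Require Import structures.
From mathcomp Require Import all_boot all_order all_algebra.
From mathcomp Require Import multinomials.mpoly.
From mathcomp Require Import Rstruct.
Notation R := Rdefinitions.R.
Set Implicit Arguments. Unset Strict Implicit. Unset Printing Implicit Defensive.
Import Order.TTheory GRing.Theory Num.Theory.
Local Open Scope ring_scope.

(** Graphs: a finite vertex type [V] with an adjacency relation [e : rel V]
    (symmetry / irreflexivity are assumed in the theorem). *)

Definition sqdist (d : nat) (x y : 'rV[R]_d) : R :=
  \sum_(i < d) (x ord0 i - y ord0 i) ^+ 2.

Definition dist (d : nat) (x y : 'rV[R]_d) : R := Num.sqrt (sqdist x y).

Definition alg_indep (I : finType) (x : I -> R) : Prop :=
  forall P : {mpoly rat[#|I|]},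
    mmap (fun c : rat => ratr c) (fun k => x (enum_val k)) P = 0 -> P = 0.

Definition generic (V : finType) (d : nat) (p : V -> 'rV[R]_d) : Prop :=
  alg_indep (fun vi : V * 'I_d => p vi.1 ord0 vi.2).

Definition equivalent (V : finType) (e : rel V) (d : nat)
  (p q : V -> 'rV[R]_d) : Prop :=
  forall u v, e u v -> dist (p u) (p v) = dist (q u) (q v).

Definition congruent (V : finType) (d : nat) (p q : V -> 'rV[R]_d) : Prop :=
  forall u v, dist (p u) (p v) = dist (q u) (q v).

Definition rigid_fw (V : finType) (e : rel V) (d : nat) (p : V -> 'rV[R]_d) : Prop :=
  exists2 eps : R, 0 < eps &
    forall q : V -> 'rV[R]_d, equivalent e p q ->
      (forall v, dist (p v) (q v) < eps) -> congruent p q.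

Definition rigid_graph (V : finType) (e : rel V) (d : nat) : Prop :=
  exists2 p : V -> 'rV[R]_d, generic p & rigid_fw e p.

Definition weakly_globally_linked (V : finType) (e : rel V) (d : nat) (u v : V) : Prop :=
  exists2 p : V -> 'rV[R]_d, generic p &
    forall q : V -> 'rV[R]_d, equivalent e p q -> dist (q u) (q v) = dist (p u) (p v).

Definition globally_loose (V : finType) (e : rel V) (d : nat) (u v : V) : Prop :=
  ~ weakly_globally_linked e d u v.

Definition totally_loose (V : finType) (e : rel V) (d : nat) : Prop :=
  forall u v, u != v -> ~~ e u v -> globally_loose e d u v.

Definition complete (V : finType) (e : rel V) : Prop :=
  forall u v, u != v -> e u v.

Definition induced (V : finType) (e : rel V) (A : {set V}) : rel {x : V | x \in A} :=
  fun x y => e (val x) (val y).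
Arguments induced {V} e A.

Definition special (d : nat) (V : finType) (e : rel V) : Prop :=
  rigid_graph e d /\
  forall A : {set V}, A != [set: V] ->
    rigid_graph (induced e A) d -> complete (induced e A).

(** Graphs obtainable from d-special graphs by a sequence of clique sums.
    A clique sum of G1 and G2 along t>=1 vertex cliques is (up to isomorphism)
    a graph G on V = A ∪ B with G[A] ≅ G1, G[B] ≅ G2, A ∩ B a clique (of size t)
    and no edge between A \ B and B \ A. *)
Inductive clique_sum_of_special (d : nat) : forall V : finType, rel V -> Prop :=
| cs_special (V : finType) (e : rel V) :
    special d e -> clique_sum_of_special d e
| cs_sum (V : finType) (e : rel V) (A B : {set V}) :
    A :|: B = [set: V] ->
    (0 < #|A :&: B|)%N ->
    (forall x y, x \in A :&: B -> y \in A :&: B -> x != y -> e x y) ->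
    (forall x y, x \in A :\: B -> y \in B :\: A -> ~~ e x y) ->
    clique_sum_of_special d (induced e A) ->
    clique_sum_of_special d (induced e B) ->
    clique_sum_of_special d e.

(* Main.v *)
From HB Require Import structures.
Require Import Defs.
From mathcomp Require Import multinomials.mpoly.
From mathcomp Require Import all_boot all_order all_algebra.
From mathcomp Require Import Rstruct polyrcf ordered_qelim qe_rcf qe_rcf_th.
From mathcomp Require reals.
From mathcomp Require Import ring lra.
From Stdlib Require Import Classical ClassicalEpsilon FunctionalExtensionality.
From Stdlib Require Raxioms.
Set Implicit Arguments. Unset Strict Implicit. Unset Printing Implicit Defensive.
Import Order.TTheory GRing.Theory Num.Theory.
Local Open Scope ring_scope.

(** If [p] is a generic rigid realization of a graph, every squared distance
    [s(p)] is algebraic over the ring [K] of values at [p] of the rational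
    polynomials that are constant on equivalence classes: otherwise, by
    quantifier elimination, the set of values of [s] on the frameworks
    equivalent to [p] inside a small rational box would contain a neighbourhood
    of [s(p)].  By genericity the algebraic relation is a polynomial identity,
    so for every generic realization each distance takes finitely many values
    among the equivalent frameworks.

    Consequently, if [G[A]] is rigid and a path outside [A] joins two vertices
    [x], [y] of [A], then [{x, y}] is weakly globally linked: put all vertices
    outside [A] so close to [x] that the distance from [x] to [y] is confined
    to an interval containing only one of these finitely many values.  So in a
    totally loose graph the attachment to [A] of each component of [G - A] is a
    clique.  When [G] is not special, take [A] proper, rigid and not complete;
    such a component yields a clique sum decomposition, whose parts are again
    rigid and totally loose. *)

(** * Quantifier elimination over a subring of constants *)

Import (canonicals) ord.

Section ConstantTracking.
Variables (F : rcfType) (K : pred F).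
Hypothesis Kratr : forall q : rat, K (ratr q).

Local Notation tF := (qe_rcf.term F).
Local Notation fF := (qe_rcf.formula F).
Local Notation cps T := ((T -> fF) -> fF).

(** Constants are tracked syntactically. The elimination procedure combines existing constants by
    term constructors, and every constant it creates is rational, so a set [K] containing the
    rationals is preserved. There are two languages to follow: general terms here, and the
    inverse-free terms of [term_over] used inside the procedure. *)
Fixpoint gterm_over (t : GRing.term F) : bool :=
  match t with
  | GRing.Var _ | GRing.NatConst _ => true
  | GRing.Const c => K c
  | GRing.Add a b | GRing.Mul a b => gterm_over a && gterm_over b
  | GRing.Opp a | GRing.Inv a | GRing.NatMul a _ | GRing.Exp a _ => gterm_over a
  end.

Fixpoint gform_over (f : ord.formula F) : bool :=
  match f with
  | ord.Bool _ => true
  | ord.Equal a b | ord.Lt a b | ord.Le a b => gterm_over a && gterm_over b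
  | ord.Unit a => gterm_over a
  | ord.And a b | ord.Or a b | ord.Implies a b => gform_over a && gform_over b
  | ord.Not a | ord.Exists _ a | ord.Forall _ a => gform_over a
  end.

Fixpoint term_over (t : tF) : bool :=
  match t with
  | qe_rcf.Var _ | qe_rcf.NatConst _ => true
  | qe_rcf.Const c => K c
  | qe_rcf.Add a b | qe_rcf.Mul a b => term_over a && term_over b
  | qe_rcf.Opp a | qe_rcf.NatMul a _ | qe_rcf.Exp a _ => term_over a
  end.

Fixpoint form_over (f : fF) : bool :=
  match f with
  | qe_rcf.Bool _ => true
  | qe_rcf.Equal a b | qe_rcf.Lt a b | qe_rcf.Le a b => term_over a && term_over b
  | qe_rcf.And a b | qe_rcf.Or a b | qe_rcf.Implies a b => form_over a && form_over b
  | qe_rcf.Not a => form_over a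
  end.

Lemma gterm_over_rterm (t : tF) : gterm_over t = term_over t.
Proof. by elim: t => //= a -> // b ->. Qed.

Lemma gform_over_qfr (f : fF) : gform_over f = form_over f.
Proof.
elim: f => //= [a b|a b|a b|a -> b ->|a -> b ->|a -> b ->] //=;
  by rewrite !gterm_over_rterm.
Qed.

Lemma term_over_to_rterm (t : GRing.term F) : gterm_over t -> term_over (qe_rcf.to_rterm t).
Proof. by elim: t => //= [a IHa b IHb|a IHa b IHb] /andP[/IHa -> /IHb ->]. Qed.

Local Notation pover := (all term_over).

Lemma const_over0 : K 0. Proof. by rewrite -(rmorph0 (@ratr F)); exact: Kratr. Qed.
Lemma const_overN1 : K (-1). Proof. by rewrite -(rmorphN1 (@ratr F)); exact: Kratr. Qed.
Lemma const_over_int n : K n%:~R. Proof. by rewrite -(@ratr_int F); exact: Kratr. Qed.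

(** The procedure is written in continuation-passing style. Each lemma of this family carries the
    property from the continuation [k] to the whole formula, by an induction that generalises
    [k]. *)
Lemma form_over_Size p k : pover p -> (forall n, form_over (k n)) ->
  form_over (Size p k).
Proof.
elim: p k => //= c p IH k /andP[hc hp] hk; apply: IH => // -[|n] //=.
by rewrite /qe_rcf.If /= hc !hk.
Qed.

Lemma form_over_Isnull p k : pover p -> (forall b, form_over (k b)) ->
  form_over (Isnull p k).
Proof. by move=> hp hk; apply: form_over_Size. Qed.

Lemma form_over_LtSize p q k : pover p -> pover q -> (forall b, form_over (k b)) ->
  form_over (LtSize p q k).
Proof. by move=> hp hq hk; apply: form_over_Size => // n; apply: form_over_Size. Qed.

Lemma form_over_LeadCoef p k : pover p ->
  (forall t, term_over t -> form_over (k t)) -> form_over (LeadCoef p k).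
Proof.
elim: p k => [|c p IH] k /=; first by move=> _; apply; apply: const_over0.
move=> /andP[hc hp] hk; apply: IH => // l hl.
by rewrite /qe_rcf.If /= hl !hk.
Qed.

Lemma pover_AmulXn a n : term_over a -> pover (AmulXn a n).
Proof. by move=> ha; elim: n => [|n IH] /=; rewrite ?ha ?const_over0. Qed.

Lemma pover_AddPoly p q : pover p -> pover q -> pover (AddPoly p q).
Proof.
elim: p q => [|a p IH] [|b q] //= /andP[-> hp] /andP[-> hq]; exact: IH.
Qed.

Lemma pover_ScalPoly c p : term_over c -> pover p -> pover (ScalPoly c p).
Proof. by move=> hc; elim: p => //= a p IH /andP[-> /IH ->]; rewrite hc. Qed.

Lemma pover_MulPoly p q : pover p -> pover q -> pover (MulPoly p q).
Proof.
move=> + hq; elim: p => //= a p IH /andP[ha /IH hp].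
by apply: pover_AddPoly; rewrite ?pover_ScalPoly.
Qed.

Lemma pover_ExpPoly p n : pover p -> pover (ExpPoly p n).
Proof.
case: n => [|n] // hp; rewrite /ExpPoly iteropS.
by elim: n => //= n IH; apply: pover_MulPoly.
Qed.

Lemma pover_OppPoly p : pover p -> pover (OppPoly p).
Proof. by apply: pover_ScalPoly; apply: const_overN1. Qed.

Lemma pover_NatMulPoly n p : pover p -> pover (NatMulPoly n p).
Proof. exact: pover_ScalPoly. Qed.

Lemma pover_Deriv p : pover p -> pover (Deriv p).
Proof. by elim: p => //= a p IH /andP[ha hp]; rewrite pover_AddPoly //= IH. Qed.

Lemma form_over_Rediv_rec_loop q sq cq c qq r n k :
  pover q -> term_over cq -> pover qq -> pover r ->
  (forall c qq r, pover qq -> pover r -> form_over (k (c, qq, r))) ->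
  form_over (Rediv_rec_loop q sq cq c qq r n k).
Proof.
move=> hq hcq; elim: n c qq r k => [|n IH] c qq r k hqq hr hk /=;
  apply: form_over_Size => // m; case: ifP => _; rewrite ?hk //;
  apply: form_over_LeadCoef => // l hl.
- by apply: hk; rewrite pover_AddPoly ?pover_MulPoly ?pover_OppPoly
    ?pover_AmulXn ?pover_MulPoly ?pover_AmulXn //= ?hcq.
- by apply: IH; rewrite ?pover_AddPoly ?pover_MulPoly ?pover_OppPoly
    ?pover_AmulXn ?pover_MulPoly ?pover_AmulXn //= ?hcq.
Qed.

Lemma form_over_Rediv p q k : pover p -> pover q ->
  (forall c qq r, pover qq -> pover r -> form_over (k (c, qq, r))) ->
  form_over (Rediv p q k).
Proof.
move=> hp hq hk; apply: form_over_Isnull => // -[]; first by rewrite hk //= const_over0.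
apply: form_over_Size => // n; apply: form_over_Size => // m.
apply: form_over_LeadCoef => // l hl.
by apply: form_over_Rediv_rec_loop => //=; rewrite const_over0.
Qed.

Lemma form_over_Rmod p q k : pover p -> pover q ->
  (forall r, pover r -> form_over (k r)) -> form_over (Rmod p q k).
Proof. by move=> hp hq hk; apply: form_over_Rediv => // c qq r _; apply: hk. Qed.

Lemma form_over_Rscal p q k : pover p -> pover q ->
  (forall n, form_over (k n)) -> form_over (Rscal p q k).
Proof. by move=> hp hq hk; apply: form_over_Rediv. Qed.

Lemma form_over_Rgcd_loop n p q k : pover p -> pover q ->
  (forall r, pover r -> form_over (k r)) -> form_over (Rgcd_loop n p q k).
Proof.
elim: n p q k => [|n IH] p q k hp hq hk /=; apply: form_over_Rmod => // r hr;
  apply: form_over_Isnull => // -[]; rewrite ?hk //; exact: IH.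
Qed.

Lemma form_over_Rgcd p q k : pover p -> pover q ->
  (forall r, pover r -> form_over (k r)) -> form_over (Rgcd p q k).
Proof.
move=> hp hq hk; apply: form_over_LtSize => // -[];
  apply: form_over_Isnull => // -[]; rewrite ?hk //;
  apply: form_over_Size => // n; exact: form_over_Rgcd_loop.
Qed.

Lemma form_over_BigRgcd ps k : all pover ps ->
  (forall r, pover r -> form_over (k r)) -> form_over (BigRgcd ps k).
Proof.
elim: ps k => [|p ps IH] k /=; first by move=> _; apply => /=; rewrite const_over0.
by move=> /andP[hp hps] hk; apply: IH => // r hr; apply: form_over_Rgcd.
Qed.

Lemma form_over_Changes s k : pover s -> (forall n, form_over (k n)) ->
  form_over (Changes s k).
Proof.
elim: s k => //= a s IH k /andP[ha hs] hk; apply: IH => // n.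
by rewrite /qe_rcf.If /= ha !hk /=; case: s hs => //= b s /andP[-> _].
Qed.

Lemma form_over_SeqPInfty ps k : all pover ps ->
  (forall s, pover s -> form_over (k s)) -> form_over (SeqPInfty ps k).
Proof.
elim: ps k => [|p ps IH] k /=; first by move=> _; apply.
move=> /andP[hp hps] hk; apply: form_over_LeadCoef => // t ht.
by apply: IH => // s hs; apply: hk; rewrite /= ht.
Qed.

Lemma form_over_SeqMInfty ps k : all pover ps ->
  (forall s, pover s -> form_over (k s)) -> form_over (SeqMInfty ps k).
Proof.
elim: ps k => [|p ps IH] k /=; first by move=> _; apply.
move=> /andP[hp hps] hk; apply: form_over_LeadCoef => // t ht.
apply: form_over_Size => // n.
by apply: IH => // s hs; apply: hk; rewrite /= const_overN1 ht.
Qed.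

Lemma form_over_ChangesPoly ps k : all pover ps -> (forall z, form_over (k z)) ->
  form_over (ChangesPoly ps k).
Proof.
move=> hps hk; apply: form_over_SeqMInfty => // m hm.
apply: form_over_SeqPInfty => // q hq.
by apply: form_over_Changes => // a; apply: form_over_Changes.
Qed.

Lemma form_over_NextMod p q k : pover p -> pover q ->
  (forall r, pover r -> form_over (k r)) -> form_over (NextMod p q k).
Proof.
move=> hp hq hk; apply: form_over_LeadCoef => // l hl.
apply: form_over_Rscal => // n; apply: form_over_Rmod => // r hr.
by apply: hk; apply: pover_ScalPoly.
Qed.

Lemma form_over_ModsAux p q n k : pover p -> pover q ->
  (forall s, all pover s -> form_over (k s)) -> form_over (ModsAux p q n k).
Proof.
elim: n p q k => [|n IH] p q k hp hq hk /=; first exact: hk.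
apply: form_over_Isnull => // -[]; rewrite ?hk //.
apply: form_over_NextMod => // r hr; apply: IH => // s hs.
by apply: hk; rewrite /= hp.
Qed.

Lemma form_over_Mods p q k : pover p -> pover q ->
  (forall s, all pover s -> form_over (k s)) -> form_over (Mods p q k).
Proof.
move=> hp hq hk; apply: form_over_Size => // n; apply: form_over_Size => // m.
exact: form_over_ModsAux.
Qed.

Lemma all_nth_nil (ps : seq (polyF F)) i : all pover ps -> pover (nth [::] ps i).
Proof. by elim: ps i => [|p ps IH] [|i] //= /andP[hp hps] //; apply: IH. Qed.

Lemma pover_PolyComb sq sc : all pover sq -> pover (PolyComb sq sc).
Proof.
move=> h; rewrite /PolyComb; elim: (iota _ _) => //= i s IH.
by apply: pover_MulPoly => //; apply: pover_ExpPoly; apply: all_nth_nil.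
Qed.

Lemma pover_Pcq sq i : all pover sq -> pover (Pcq sq i).
Proof.
move=> h; apply: all_nth_nil; elim: (sg_tab _) => //= sc s ->.
by rewrite pover_PolyComb.
Qed.

Lemma form_over_TaqsR p sq i k : pover p -> all pover sq ->
  (forall t, term_over t -> form_over (k t)) -> form_over (TaqsR p sq i k).
Proof.
move=> hp hsq hk; apply: form_over_Mods => //.
  by rewrite pover_MulPoly ?pover_Deriv ?pover_Pcq.
by move=> s hs; apply: form_over_ChangesPoly => // z; apply: hk; apply: const_over_int.
Qed.

(* Entries of the inverse of an integer matrix, hence rational. *)
Lemma const_over_coefs n i : K (coefs F n i).
Proof.
suff [q ->] : exists q : rat, coefs F n i = ratr q by exact: Kratr.
rewrite /coefs; case: (ltnP i (3 ^ n)) => hi; last first.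
  by exists 0; rewrite rmorph0 nth_default // size_map size_enum_ord.
rewrite (nth_map (Ordinal hi)) ?size_enum_ord // castmxE /=.
set j := cast_ord _ _; set l := cast_ord _ _.
exists (invmx (map_mx (intr : int -> rat) (ctmat n)) j l).
transitivity ((map_mx ratr (invmx (map_mx (intr : int -> rat) (ctmat n))) : 'M[F]_(3 ^ n)) j l);
  last by rewrite mxE.
rewrite map_invmx -map_mx_comp; congr (invmx _ _ _).
by apply: eq_map_mx => z /=; rewrite ratr_int.
Qed.

Lemma const_over_Coefs n i : K (match n with
    | 0 => (i == 0%N)%:R
    | 1 => [:: 2%:R^-1; 2%:R^-1; 0]`_i
    | n => coefs F n i
  end).
Proof.
have Khalf : K 2%:R^-1 by rewrite -(ratr_nat F) -fmorphV; exact: Kratr.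
case: n => [|[|n]]; last exact: const_over_coefs.
- by rewrite -(ratr_nat F); exact: Kratr.
- by case: i => [|[|[|i]]] //=; rewrite ?const_over0 // nth_nil const_over0.
Qed.

Lemma form_over_CcountWeak p sq k : pover p -> all pover sq ->
  (forall t, term_over t -> form_over (k t)) -> form_over (CcountWeak p sq k).
Proof.
move=> hp hsq; rewrite /CcountWeak.
(* The weighted sum of Tarski queries is accumulated in a term that starts at 0; the induction on
   the number of queries generalises this accumulator. *)
have : term_over (qe_rcf.NatConst F 0) by [].
elim: (3 ^ size sq)%N (qe_rcf.NatConst F 0) k => [|n IH] t k ht hk; first exact: hk.
apply: form_over_TaqsR => // x hx; apply: IH => //=.
by rewrite hx ht const_over_Coefs.
Qed.

Lemma pover_BoundingPoly sq : all pover sq -> pover (BoundingPoly sq).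
Proof.
move=> h; apply: pover_Deriv.
by elim: sq h => //= p sq IH /andP[hp /IH h]; apply: pover_MulPoly.
Qed.

Lemma form_over_CcountGt0 sp sq : all pover sp -> all pover sq ->
  form_over (CcountGt0 sp sq).
Proof.
move=> hsp hsq; apply: form_over_BigRgcd => // p hp.
apply: form_over_Isnull => // -[] /=; last first.
  by apply: form_over_CcountWeak => // t ht /=.
(* Here the gcd of the equations is zero. The strict inequalities are then tested at the critical
   points of their product and, through leading coefficients, at both infinities. *)
apply: form_over_CcountWeak => //; first exact: pover_BoundingPoly.
move=> t ht /=; rewrite ht andbT.
elim: sq hsq => //= q sq IH /andP[hq /IH /andP[-> ->]]; rewrite !andbT.
apply/andP; split; first exact: form_over_LeadCoef.
apply: form_over_Size => // n; apply: form_over_LeadCoef => // l hl /=.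
Qed.

Lemma pover_abstrX i t : term_over t -> pover (abstrX i t).
Proof.
elim: t => //=.
- by move=> n; case: ifP.
- by move=> c ->.
- by move=> a IHa b IHb /andP[/IHa ? /IHb ?]; apply: pover_AddPoly.
- by move=> a IHa /IHa; apply: pover_OppPoly.
- by move=> a IHa n /IHa; apply: pover_NatMulPoly.
- by move=> a IHa b IHb /andP[/IHa ? /IHb ?]; apply: pover_MulPoly.
- by move=> a IHa n /IHa; apply: pover_ExpPoly.
Qed.

Lemma gform_over_wproj i bc : all gterm_over bc.1 -> all gterm_over bc.2 ->
  gform_over (wproj i bc).
Proof.
move=> h1 h2; rewrite gform_over_qfr; apply: form_over_CcountGt0;
  rewrite all_map; apply: sub_all; try exact: h1; try exact: h2;
  by move=> t /= /term_over_to_rterm /pover_abstrX.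
Qed.

Local Notation clause_over c := (all gterm_over (ord.terms_of_oclause c)).

Lemma clause_over_and cs1 cs2 : all (fun c => clause_over c) cs1 ->
  all (fun c => clause_over c) cs2 ->
  all (fun c => clause_over c) (ord.and_odnf cs1 cs2).
Proof.
move=> h1 h2; rewrite /ord.and_odnf; elim: cs1 h1 => [|c1 cs1 IH] /=.
  by rewrite big_nil.
move=> /andP[hc1 /IH h]; rewrite big_cons all_cat h andbT all_map.
apply: sub_all h2 => c2 /=.
case: c1 c2 hc1 => [a1 a2 a3 a4] [b1 b2 b3 b4] /=.
by rewrite !all_cat => /and4P[-> -> -> ->] /and4P[-> -> -> ->].
Qed.

Lemma clause_over_qf_to_odnf f b : gform_over f ->
  all (fun c => clause_over c) (ord.qf_to_odnf f b).
Proof.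
elim: f b => //=.
- by move=> [] [].
- by move=> t1 t2 [] /andP[h1 h2] /=; rewrite h1 h2.
- by move=> t1 t2 [] /andP[h1 h2] /=; rewrite h1 h2.
- by move=> t1 t2 [] /andP[h1 h2] /=; rewrite h1 h2.
- by move=> t [].
- by move=> f IHf g IHg [] /andP[/IHf hf /IHg hg]; rewrite ?all_cat ?hf ?hg // clause_over_and.
- by move=> f IHf g IHg [] /andP[/IHf hf /IHg hg]; rewrite ?all_cat ?hf ?hg // clause_over_and.
- by move=> f IHf g IHg [] /andP[/IHf hf /IHg hg]; rewrite ?all_cat ?hf ?hg // clause_over_and.
- by move=> f IHf b /IHf.
- by move=> n f _ [].
- by move=> n f _ [].
Qed.

Lemma gform_over_proj i c : clause_over c -> gform_over (ord.proj (@wproj F) i c).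
Proof.
move=> hc; rewrite /ord.proj /ord.oclause_to_w.
(* Removing the literals with a disequality or a large inequality only produces terms of [c], up to
   sign. *)
have : {in ord.oclause_neq_leq_elim c, forall c', clause_over c'}.
  move=> c' /ord.terms_of_neq_leq_elim sub; apply/allP => t /sub.
  rewrite mem_cat => /orP[/(allP hc) //|/mapP[u hu ->]] /=.
  by case: c hc hu {sub} => a1 a2 a3 a4 /= /allP h hu; apply: h; rewrite !mem_cat hu orbT.
elim: (ord.oclause_neq_leq_elim c) => //= c' cs IH h.
apply/andP; split; last by apply: IH => c'' hc''; apply: h; rewrite in_cons hc'' orbT.
have := h c' (mem_head _ _); case: c' h => a1 a2 a3 a4 _ /=.
rewrite !all_cat => /and4P[h1 _ h3 _]; exact: gform_over_wproj.
Qed.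

Lemma gform_over_quantifier_elim f : gform_over f ->
  gform_over (ord.quantifier_elim (@wproj F) f).
Proof.
have aux g n : gform_over g ->
    gform_over (foldr (@ord.Or F) (ord.Bool false)
      (map (ord.proj (@wproj F) n) (ord.qf_to_odnf g false))).
  move=> /(clause_over_qf_to_odnf false).
  by elim: (ord.qf_to_odnf g false) => //= c cs IH /andP[/gform_over_proj -> /IH ->].
elim: f => //= [f IHf g IHg|f IHf g IHg|f IHf g IHg|n f IHf|n f IHf];
  try by move=> /andP[/IHf -> /IHg ->].
- by move=> /IHf; apply: aux.
- by move=> /IHf h; apply: (aux (ord.Not _)).
Qed.

End ConstantTracking.

(** * Formulas near a point transcendental over the constants *)

Section Transcendental.
Variables (F : rcfType) (K : pred F).
Hypothesis Kratr : forall q : rat, K (ratr q).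
Hypothesis KD : forall x y, K x -> K y -> K (x + y).
Hypothesis KM : forall x y, K x -> K y -> K (x * y).

Definition poly_over (P : {poly F}) := forall i, K P`_i.

Lemma poly_overC c : K c -> poly_over c%:P.
Proof. by move=> hc i; rewrite coefC; case: ifP => // _; apply: const_over0. Qed.

Lemma poly_overD P Q : poly_over P -> poly_over Q -> poly_over (P + Q).
Proof. by move=> hP hQ i; rewrite coefD; apply: KD. Qed.

Lemma poly_overM P Q : poly_over P -> poly_over Q -> poly_over (P * Q).
Proof.
move=> hP hQ i; rewrite coefM; elim/big_ind: _ => //; first exact: const_over0.
by move=> j _; apply: KM.
Qed.

Lemma poly_overN P : poly_over P -> poly_over (- P).
Proof.
move=> hP; rewrite -mulN1r -polyCN; apply: poly_overM => //.
by apply: poly_overC; apply: const_overN1.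
Qed.

Lemma const_over_nat n : K n%:R. Proof. by rewrite -(ratr_nat F); exact: Kratr. Qed.

Lemma gterm_over_poly t : gterm_over K t -> GRing.rterm t ->
  exists2 P, poly_over P & forall x, GRing.eval [:: x] t = P.[x].
Proof.
elim: t => //=.
(* In the environment [[:: x]] variable 0 is [x] and every further variable reads the default value
   0. *)
- move=> [|n] _ _; [exists 'X => [i|x]|exists 0 => [i|x]].
  + by rewrite coefX; exact: const_over_nat.
  + by rewrite hornerX.
  + by rewrite coef0; exact: const_over0.
  + by rewrite horner0 /= nth_nil.
- move=> c hc _; exists c%:P => [|x]; last by rewrite hornerC.
  exact: poly_overC.
- move=> n _ _; exists n%:R%:P => [|x]; last by rewrite hornerC.
  by apply: poly_overC; apply: const_over_nat.
- move=> a IHa b IHb /andP[/IHa ha /IHb hb] /andP[/ha[P hP eP] /hb[Q hQ eQ]].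
  exists (P + Q) => [|x]; last by rewrite hornerD eP eQ.
  exact: poly_overD.
- move=> a IHa /IHa ha /ha[P hP eP].
  exists (- P) => [|x]; last by rewrite hornerN eP.
  exact: poly_overN.
- move=> a IHa n /IHa ha /ha[P hP eP].
  exists (P * n%:R%:P) => [|x]; last by rewrite hornerM hornerC eP mulr_natr.
  by apply: poly_overM => //; apply: poly_overC; apply: const_over_nat.
- move=> a IHa b IHb /andP[/IHa ha /IHb hb] /andP[/ha[P hP eP] /hb[Q hQ eQ]].
  exists (P * Q) => [|x]; last by rewrite hornerM eP eQ.
  exact: poly_overM.
- move=> a IHa n /IHa ha /ha[P hP eP].
  exists (P ^+ n) => [|x]; last by rewrite horner_exp eP.
  elim: n => [|n IH]; last by rewrite exprS; apply: poly_overM.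
  by apply: poly_overC; apply: (const_over_nat 1).
Qed.

Variable t0 : F.
Hypothesis t0_transc : forall P, poly_over P -> P.[t0] = 0 -> P = 0.

(** Either [P] vanishes at [t0] and is then the zero polynomial, or continuity keeps it away from 0
    near [t0]. *)
Lemma poly_over_sgr_near P : poly_over P ->
  exists2 dl, 0 < dl & forall x, `|x - t0| < dl -> Num.sg P.[x] = Num.sg P.[t0].
Proof.
move=> /t0_transc hP; have [/hP ->|nz] := eqVneq P.[t0] 0.
  by exists 1 => // x _; rewrite !horner0.
have e0 : 0 < `|P.[t0]| by rewrite normr_gt0.
have [dl dl0 hdl] := @poly_cont F t0 P _ e0.
exists dl => // x /hdl {hdl}.
case: (ltrgt0P P.[t0]) nz => // h _; rewrite ltr_norml => /andP[h1 h2].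
- by rewrite !gtr0_sg //; lra.
- by rewrite !ltr0_sg //; lra.
Qed.

(** An atom comparing [a] with [b] is decided by the sign of [a - b], a polynomial over [K] in the
    one free variable; a connective takes the smaller of two neighbourhoods. *)
Lemma qf_eval_near f : gform_over K f -> ord.rformula f -> ord.qf_form f ->
  exists2 dl, 0 < dl &
    forall x, `|x - t0| < dl -> ord.qf_eval [:: x] f = ord.qf_eval [:: t0] f.
Proof.
have diff a b : gterm_over K a && gterm_over K b -> GRing.rterm a && GRing.rterm b ->
    exists2 dl, 0 < dl & forall x, `|x - t0| < dl ->
      Num.sg (GRing.eval [:: x] a - GRing.eval [:: x] b) =
      Num.sg (GRing.eval [:: t0] a - GRing.eval [:: t0] b).
  move=> /andP[ha hb] /andP[ra rb].
  have [P hP eP] := gterm_over_poly ha ra.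
  have [Q hQ eQ] := gterm_over_poly hb rb.
  have [dl dl0 hdl] := poly_over_sgr_near (poly_overD hP (poly_overN hQ)).
  by exists dl => // x /hdl; rewrite !eP !eQ !hornerE.
have two f1 f2 (op : bool -> bool -> bool) :
    (exists2 dl, 0 < dl & forall x, `|x - t0| < dl ->
      ord.qf_eval [:: x] f1 = ord.qf_eval [:: t0] f1) ->
    (exists2 dl, 0 < dl & forall x, `|x - t0| < dl ->
      ord.qf_eval [:: x] f2 = ord.qf_eval [:: t0] f2) ->
    exists2 dl, 0 < dl & forall x, `|x - t0| < dl ->
      op (ord.qf_eval [:: x] f1) (ord.qf_eval [:: x] f2) =
      op (ord.qf_eval [:: t0] f1) (ord.qf_eval [:: t0] f2).
  move=> [d1 p1 h1] [d2 p2 h2]; exists (Num.min d1 d2); first by rewrite lt_min p1.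
  by move=> x; rewrite lt_min => /andP[/h1 -> /h2 ->].
elim: f => //=.
- by move=> b _ _ _; exists 1.
- move=> a b ha ra _; have [dl dl0 h] := diff _ _ ha ra; exists dl => // x /h e.
  by rewrite -subr_eq0 -sgr_eq0 e sgr_eq0 subr_eq0.
- move=> a b ha ra _; have [dl dl0 h] := diff _ _ ha ra; exists dl => // x /h e.
  by rewrite -subr_lt0 -sgr_lt0 e sgr_lt0 subr_lt0.
- move=> a b ha ra _; have [dl dl0 h] := diff _ _ ha ra; exists dl => // x /h e.
  by rewrite -subr_le0 -sgr_le0 e sgr_le0 subr_le0.
- move=> f IHf g IHg /andP[/IHf hf /IHg hg] /andP[/hf{}hf /hg{}hg] /andP[/hf{}hf /hg{}hg].
  exact: (two f g andb).
- move=> f IHf g IHg /andP[/IHf hf /IHg hg] /andP[/hf{}hf /hg{}hg] /andP[/hf{}hf /hg{}hg].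
  exact: (two f g orb).
- move=> f IHf g IHg /andP[/IHf hf /IHg hg] /andP[/hf{}hf /hg{}hg] /andP[/hf{}hf /hg{}hg].
  exact: (two f g implb).
- move=> f IHf /IHf hf /hf{}hf /hf[dl dl0 h]; exists dl => // x /h -> //.
Qed.

Lemma holds_Exists_iota e n f :
  ord.holds e (foldr (@ord.Exists F) f (iota (size e) n)) <->
  exists2 xs, size xs = n & ord.holds (e ++ xs) f.
Proof.
elim: n e => [|n IH] e /=.
  split=> [h|[xs /size0nil ->]]; last by rewrite cats0.
  by exists [::]; rewrite ?cats0.
(* The first unassigned index is [size e], so the assignment extends the environment without leaving
   a gap filled by defaults. *)
have rc x : set_nth 0 e (size e) x = rcons e x.
  by elim: e {IH} => //= a e ->.
split=> [[x]|[[|x xs] // [sz] h]].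
  rewrite rc -(size_rcons e x) => /IH[xs sz h]; exists (x :: xs) => /=.
    by rewrite sz.
  by rewrite -cat_rcons.
exists x; rewrite rc -(size_rcons e x); apply/IH; exists xs => //.
by rewrite cat_rcons.
Qed.

(* By quantifier elimination, the truth of the projected formula at [t] only
   depends on the signs of finitely many polynomials in [t] over [K]; none of
   them changes sign at a point transcendental over [K]. *)
Lemma exists_holds_near n f : gform_over K f -> ord.rformula f ->
  (exists2 xs, size xs = n & ord.holds (t0 :: xs) f) ->
  exists2 dl, 0 < dl & forall t, `|t - t0| < dl ->
    exists2 xs, size xs = n & ord.holds (t :: xs) f.
Proof.
move=> hf rf h0; pose g := foldr (@ord.Exists F) f (iota 1 n).
have rg : ord.rformula g by rewrite /g; elim: (iota 1 n).
have hg : gform_over K g by rewrite /g; elim: (iota 1 n).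
have gP e := ord.quantifier_elim_rformP (@wf_QE_wproj F) (@valid_QE_wproj F) e rg.
have /andP[qfq rq] := ord.quantifier_elim_wf (@wf_QE_wproj F) rg.
have [dl dl0 h] := qf_eval_near (gform_over_quantifier_elim Kratr hg) rq qfq.
exists dl => // t /h e; apply/(holds_Exists_iota [:: t]).
by apply/gP; rewrite e; apply/gP/(holds_Exists_iota [:: t0]).
Qed.

End Transcendental.

(** * Finitely many distances in equivalent frameworks *)

Lemma sqdist_ge0 d (x y : 'rV[R]_d) : 0 <= sqdist x y.
Proof. by apply: sumr_ge0 => i _; apply: sqr_ge0. Qed.

Lemma dist_ge0 d (x y : 'rV[R]_d) : 0 <= dist x y.
Proof. exact: sqrtr_ge0. Qed.

Lemma sqr_dist d (x y : 'rV[R]_d) : dist x y ^+ 2 = sqdist x y.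
Proof. by rewrite sqr_sqrtr ?sqdist_ge0. Qed.

Lemma dist_eq d (x y x' y' : 'rV[R]_d) :
  dist x y = dist x' y' <-> sqdist x y = sqdist x' y'.
Proof. by split=> [h|h]; [rewrite -!sqr_dist h | rewrite /dist h]. Qed.

(** The squared distance is at most [d * h ^+ 2], and [d <= d ^ 2] for natural numbers. *)
Lemma dist_le_coord d (x y : 'rV[R]_d) (h : R) : 0 <= h ->
  (forall i, `|x ord0 i - y ord0 i| <= h) -> dist x y <= d%:R * h.
Proof.
move=> h0 hi; have dh0 : 0 <= d%:R * h by apply: mulr_ge0.
rewrite -(ler_pXn2r (n := 2)) ?nnegrE ?dist_ge0 // sqr_dist.
apply: (@le_trans _ _ (\sum_(i < d) h ^+ 2)).
  apply: ler_sum => i _; rewrite -real_normK ?num_real //.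
  by rewrite ler_pXn2r ?nnegrE.
rewrite sumr_const card_ord -[h ^+ 2 *+ d]mulr_natl exprMn.
by rewrite ler_wpM2r ?sqr_ge0 // -natrX ler_nat; case: (d) => // k; rewrite expnS expn1 leq_pmulr.
Qed.

(** * Evaluation of rational polynomials as a ring morphism *)

Section Evaluation.
Variables (I : finType).
Implicit Types (x : I -> R) (P : {mpoly rat[#|I|]}).

Definition mev x P : R := mmap (@ratr R) (fun k => x (enum_val k)) P.

Lemma mev_is_additive x : additive (mev x).
Proof. exact: mmap_is_additive. Qed.
Lemma mev_is_multiplicative x : multiplicative (mev x).
Proof. exact: mmap_is_multiplicative. Qed.
HB.instance Definition _ x :=
  GRing.isAdditive.Build {mpoly rat[#|I|]} R (mev x) (mev_is_additive x).
HB.instance Definition _ x :=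
  GRing.isMultiplicative.Build {mpoly rat[#|I|]} R (mev x) (mev_is_multiplicative x).

Lemma mevC x c : mev x c%:MP = ratr c.
Proof. exact: mmapC. Qed.

Definition mvar (i : I) : {mpoly rat[#|I|]} := 'X_(enum_rank i).

Lemma mevX x i : mev x (mvar i) = x i.
Proof. by rewrite /mev mmapX mmap1U enum_rankK. Qed.
End Evaluation.

Section Algebraic.
Variables (V : finType) (e : rel V) (d : nat).
Implicit Types (p q : V -> 'rV[R]_d) (u v : V).
Local Notation I := (V * 'I_d)%type.
Local Notation M := {mpoly rat[#|{: V * 'I_d}|]}.

Definition coords p : I -> R := fun vi => p vi.1 ord0 vi.2.

Definition sqdist_poly u v : M := \sum_(i < d) (mvar (u, i) - mvar (v, i)) ^+ 2.

Lemma mev_sqdist_poly p u v : mev (coords p) (sqdist_poly u v) = sqdist (p u) (p v).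
Proof.
rewrite rmorph_sum; apply: eq_bigr => i _.
by rewrite rmorphXn rmorphB /= !mevX.
Qed.

(** A semantic substitute for the polynomials in the squared edge lengths: it contains these, and
    invariance is what transfers a relation from a framework to all equivalent ones. *)
Definition edge_invariant (f : M) :=
  forall p q, equivalent e p q -> mev (coords p) f = mev (coords q) f.

(** The ring [K] of constants for quantifier elimination, made Boolean by informative excluded
    middle. *)
Definition invariant_values p : pred R := fun x =>
  if excluded_middle_informative
    (exists2 f, edge_invariant f & mev (coords p) f = x) then true else false.

Lemma invariant_valuesP p x :
  reflect (exists2 f, edge_invariant f & mev (coords p) f = x) (invariant_values p x).
Proof. by rewrite /invariant_values; case: excluded_middle_informative => h; constructor. Qed.

Lemma invariant_values_ratr p (c : rat) : invariant_values p (ratr c).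
Proof. by apply/invariant_valuesP; exists c%:MP => [q q' _|]; rewrite !mevC. Qed.

Lemma invariant_valuesD p x y : invariant_values p x -> invariant_values p y ->
  invariant_values p (x + y).
Proof.
move=> /invariant_valuesP[f hf <-] /invariant_valuesP[g hg <-].
apply/invariant_valuesP; exists (f + g) => [q q' h|]; rewrite !rmorphD //=.
by rewrite (hf _ _ h) (hg _ _ h).
Qed.

Lemma invariant_valuesM p x y : invariant_values p x -> invariant_values p y ->
  invariant_values p (x * y).
Proof.
move=> /invariant_valuesP[f hf <-] /invariant_valuesP[g hg <-].
apply/invariant_valuesP; exists (f * g) => [q q' h|]; rewrite !rmorphM //=.
by rewrite (hf _ _ h) (hg _ _ h).
Qed.

Lemma invariant_values_edge p u v : e u v -> invariant_values p (sqdist (p u) (p v)).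
Proof.
move=> uv; apply/invariant_valuesP; exists (sqdist_poly u v) => [q q' h|];
  rewrite !mev_sqdist_poly //.
by apply/dist_eq; apply: h.
Qed.

(** Variable 0 is reserved for the squared distance under study, so coordinates start at 1;
    [framework_of] reads the list without that head. *)
Definition cvar (i : I) : nat := (enum_rank i).+1.

Definition sqdist_term u v : GRing.term R :=
  foldr (fun i => GRing.Add (GRing.Exp (GRing.Add (GRing.Var _ (cvar (u, i)))
    (GRing.Opp (GRing.Var _ (cvar (v, i))))) 2)) (GRing.NatConst _ 0) (enum 'I_d).

Definition framework_of (xs : seq R) : V -> 'rV[R]_d :=
  fun v => \row_i xs`_(enum_rank (v, i)).

Lemma eval_sqdist_term t xs u v : GRing.eval (t :: xs) (sqdist_term u v) =
  sqdist (framework_of xs u) (framework_of xs v).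
Proof.
rewrite /sqdist -big_enum /sqdist_term.
elim: (enum _) => [|i s IH] /=; first by rewrite big_nil.
by rewrite big_cons IH /= !mxE.
Qed.

Definition conj_all (T : Type) (s : seq T) (g : T -> ord.formula R) : ord.formula R :=
  foldr (fun x => ord.And (g x)) (ord.Bool true) s.

Lemma holds_conj_all (T : eqType) (s : seq T) g xs :
  ord.holds xs (conj_all s g) <-> {in s, forall x, ord.holds xs (g x)}.
Proof.
elim: s => [|x s IH] /=; first by split.
split=> [[hx /IH hs] y|h].
  by rewrite in_cons => /orP[/eqP -> //|/hs].
split; first by apply: h; rewrite mem_head.
by apply/IH => y ys; apply: h; rewrite in_cons ys orbT.
Qed.

Lemma gform_over_conj_all K (T : eqType) (s : seq T) g :
  {in s, forall x, gform_over K (g x)} -> gform_over K (conj_all s g).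
Proof.
elim: s => //= x s IH h; apply/andP; split; first by apply: h; rewrite mem_head.
by apply: IH => y ys; apply: h; rewrite in_cons ys orbT.
Qed.

Lemma rformula_conj_all (T : eqType) (s : seq T) g :
  (forall x, ord.rformula (g x)) -> ord.rformula (conj_all s g).
Proof. by move=> h; elim: s => //= x s ->; rewrite h. Qed.

(* [exists] of this formula over the variables [cvar]: some framework in the
   box with sides [a], [b] is equivalent to [p] and has the squared distance
   from [u] to [v] equal to the value of the variable 0. *)
Definition near_formula p (a b : I -> rat) u v : ord.formula R :=
  ord.And (ord.Equal (sqdist_term u v) (GRing.Var _ 0))
 (ord.And (conj_all (enum {: V * V}) (fun uv =>
     if e uv.1 uv.2 then ord.Equal (sqdist_term uv.1 uv.2)
       (GRing.Const (sqdist (p uv.1) (p uv.2))) else ord.Bool true))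
   (conj_all (enum {: V * 'I_d}) (fun vi =>
     ord.And (ord.Lt (GRing.Const (ratr (a vi))) (GRing.Var _ (cvar vi)))
             (ord.Lt (GRing.Var _ (cvar vi)) (GRing.Const (ratr (b vi))))))).

Lemma holds_near_formula p a b u v t xs :
  ord.holds (t :: xs) (near_formula p a b u v) <->
  [/\ sqdist (framework_of xs u) (framework_of xs v) = t,
      equivalent e p (framework_of xs) &
      forall w i, ratr (a (w, i)) < framework_of xs w ord0 i < ratr (b (w, i))].
Proof.
rewrite /near_formula /= eval_sqdist_term !holds_conj_all.
split=> [[h1 [h2 h3]]|[h1 h2 h3]]; split=> //.
- move=> w z wz; apply/dist_eq.
  have := h2 (w, z); rewrite mem_enum inE /= wz => /(_ isT) /= <-.
  by rewrite eval_sqdist_term.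
- move=> w i; have := h3 (w, i); rewrite mem_enum inE /= => /(_ isT) [].
  by rewrite mxE => -> ->.
- split=> [[w z] _ /=|[w i] _ /=].
    case: ifP => //= wz; rewrite eval_sqdist_term; apply/dist_eq.
    by rewrite (h2 _ _ wz).
  by have := h3 w i; rewrite mxE => /andP[].
Qed.

Lemma gform_over_near_formula p a b u v :
  gform_over (invariant_values p) (near_formula p a b u v).
Proof.
have hs w z : gterm_over (invariant_values p) (sqdist_term w z).
  by rewrite /sqdist_term; elim: (enum _).
rewrite /= hs /=; apply/andP; split; apply: gform_over_conj_all => -[w z] _ /=.
- by case: ifP => //= wz; rewrite hs invariant_values_edge.
- by rewrite !invariant_values_ratr.
Qed.

Lemma rformula_near_formula p a b u v : ord.rformula (near_formula p a b u v).
Proof.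
have hs w z : GRing.rterm (sqdist_term w z).
  by rewrite /sqdist_term; elim: (enum _).
by rewrite /= hs !rformula_conj_all // => -[w z] /=; case: ifP => //=; rewrite hs.
Qed.

Lemma framework_ofK p :
  framework_of [seq coords p (enum_val k) | k <- enum 'I_#|{: V * 'I_d}|] =1 p.
Proof.
move=> v; apply/rowP => i; rewrite !mxE (nth_map (enum_rank (v, i))).
  by rewrite nth_ord_enum enum_rankK.
by rewrite size_enum_ord.
Qed.

Lemma rigid_fw_transcendental p u v : rigid_fw e p ->
  ~ (forall P, poly_over (invariant_values p) P ->
       P.[sqdist (p u) (p v)] = 0 -> P = 0).
Proof.
move=> [eps eps0 rig] tr.
(* A box of half-side at most [h] keeps each vertex within [d * h] of its place; the denominator
   [d.+1] is nonzero and makes this strictly less than [eps]. *)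
pose h := eps / d.+1%:R.
have h0 : 0 < h by rewrite divr_gt0 ?ltr0n.
(* The sides are rational so that the formula describing the box has its constants in [K]. *)
have aP (vi : I) : exists a : rat, coords p vi - h < ratr a < coords p vi.
  have [|a] := @reals.rat_in_itvoo R (coords p vi - h) (coords p vi); first by lra.
  by rewrite in_itv /=; exists a.
have bP (vi : I) : exists b : rat, coords p vi < ratr b < coords p vi + h.
  have [|a] := @reals.rat_in_itvoo R (coords p vi) (coords p vi + h); first by lra.
  by rewrite in_itv /=; exists a.
have [a {}aP] := fin_all_exists aP; have [b {}bP] := fin_all_exists bP.
have Kr := @invariant_values_ratr p.
have KD := @invariant_valuesD p.
have KM := @invariant_valuesM p.
have [] := exists_holds_near Kr KD KM tr (gform_over_near_formula p a b u v)
  (rformula_near_formula p a b u v) (n := #|{: V * 'I_d}|).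
  exists [seq coords p (enum_val k) | k <- enum 'I_#|{: V * 'I_d}|].
    by rewrite size_map size_enum_ord.
  apply/holds_near_formula; split; first by rewrite !framework_ofK.
    by move=> w z _; rewrite !framework_ofK.
  move=> w i; rewrite framework_ofK.
  by have /andP[_ ->] := aP (w, i); have /andP[-> _] := bP (w, i).
(* A framework in the box, equivalent to [p] but with squared distance shifted by [dl / 2],
   contradicts rigidity. *)
move=> dl dl0 /(_ (sqdist (p u) (p v) + dl / 2)) [].
  by rewrite addrAC subrr add0r gtr0_norm; lra.
move=> xs _ /holds_near_formula[ht heq hbox].
suff : congruent p (framework_of xs).
  by move=> /(_ u v) /dist_eq; rewrite ht; lra.
apply: rig => // w; apply: (@le_lt_trans _ _ (d%:R * h)).
  apply: dist_le_coord => [|i]; first exact: ltW.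
  have /andP[x1 x2] := hbox w i; have /andP[y1 _] := aP (w, i).
  have /andP[_ y2] := bP (w, i); rewrite /coords /= in y1 y2.
  by rewrite ler_norml; apply/andP; split; lra.
rewrite mulrC -mulrA gtr_pMr // mulrC ltr_pdivrMr ?ltr0n // mul1r ltr_nat.
exact: ltnSn.
Qed.

(** Failure of transcendence gives a nonzero real polynomial whose coefficients are values at [p] of
    edge invariants. Choosing one invariant per coefficient lifts it to a polynomial over [M]. *)
Lemma rigid_fw_algebraic p u v : rigid_fw e p ->
  exists P : {poly M}, [/\ forall i, edge_invariant P`_i,
    map_poly (mev (coords p)) P != 0 &
    (map_poly (mev (coords p)) P).[sqdist (p u) (p v)] = 0].
Proof.
move=> /(@rigid_fw_transcendental _ u v) /not_all_ex_not[P].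
move=> nP; have [hP nP'] := imply_to_and _ _ nP; have [rP nzP] := imply_to_and _ _ nP'.
have hf (i : 'I_(size P)) : exists f, edge_invariant f /\ mev (coords p) f = P`_i.
  by have /invariant_valuesP[f] := hP i; exists f.
have [f hf'] := fin_all_exists hf.
pose Q : {poly M} := \sum_(i < size P) (f i)%:P * 'X^i.
have mQ : map_poly (mev (coords p)) Q = P.
  rewrite rmorph_sum /= -[RHS]coefK poly_def; apply: eq_bigr => i _.
  by rewrite rmorphM /= map_polyXn map_polyC /= (hf' i).2 mul_polyC.
exists Q; rewrite mQ; split=> //; last by apply/eqP.
move=> i; rewrite coef_sum; elim/big_ind: _ => [q q' _|g g' hg hg' q q' h|j _].
- by rewrite !rmorph0.
- by rewrite !rmorphD /= (hg _ _ h) (hg' _ _ h).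
- rewrite coefCM coefXn; case: (i == j) => q q' h; last by rewrite !mulr0 !rmorph0.
  by rewrite !mulr1; apply: (hf' j).1.
Qed.

Lemma generic_mev_eq0 p (f : M) : generic p -> mev (coords p) f = 0 -> f = 0.
Proof. by move=> gp; apply: gp. Qed.

(** The relation found at the rigid generic [p0] is a polynomial identity, so it holds at every [q].
    By invariance its coefficients at [q] are those at [p], and they are not all zero because a
    coefficient vanishing at the generic [p] is the zero polynomial. The squared distance at [q] is
    thus a root of a nonzero polynomial that depends on [p] only. *)
Lemma rigid_graph_finite_dist p u v : rigid_graph e d -> generic p ->
  exists L : seq R, forall q, equivalent e p q -> dist (q u) (q v) \in L.
Proof.
move=> [p0 gp0 /(@rigid_fw_algebraic _ u v) [P [Pinv Pnz P0]]] gp.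
have S0 : P.[sqdist_poly u v] = 0.
  by apply: (generic_mev_eq0 gp0); rewrite -horner_map /= mev_sqdist_poly.
have nz : map_poly (mev (coords p)) P != 0.
  apply: contra_neq Pnz => /polyP hp; apply/polyP => i.
  have := hp i; rewrite !coef_map !coef0 /= => /(generic_mev_eq0 gp) ->.
  by rewrite rmorph0.
exists (map Num.sqrt (rootsR (map_poly (mev (coords p)) P))) => q eq_pq.
apply: map_f; rewrite -roots_on_rootsR // in_itv /=.
rewrite (_ : map_poly _ P = map_poly (mev (coords q)) P); last first.
  by apply/polyP => i; rewrite !coef_map /=; apply: Pinv.
by rewrite /root -mev_sqdist_poly horner_map S0 rmorph0.
Qed.

End Algebraic.

(** * Generic extension *)

Lemma mpoly_rmorph_ext n (A : nzRingType) (S : nzRingType)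
    (f g : {rmorphism {mpoly A[n]} -> S}) :
  (forall c, f c%:MP = g c%:MP) -> (forall i, f 'X_i = g 'X_i) -> f =1 g.
Proof.
move=> hC hX P; rewrite (mpolyE P) !rmorph_sum /=; apply: eq_bigr => m _.
rewrite -mul_mpolyC !rmorphM /= hC; congr (_ * _).
rewrite mpolyXE_id !rmorph_prod; apply: eq_bigr => i _.
by rewrite !rmorphXn /= hX.
Qed.

(* Nested intervals; the n-th halving step discards [u n]. *)
Lemma real_avoiding_sequence (u : nat -> R) (a b : R) : a < b ->
  exists2 r : R, a < r < b & forall n, u n != r.
Proof.
move=> ab.
(* The lower branch ends strictly below the midpoint, so [u n = m] is excluded from the closed
   interval too. Starting with the middle third puts the limit strictly between [a] and [b]. *)
pose step n (I : R * R) := let m := (I.1 + I.2) / 2 in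
  if u n < m then (m, I.2) else (I.1, (I.1 + m) / 2).
pose seqI := fix seqI n := if n is n'.+1 then step n' (seqI n')
  else ((2 * a + b) / 3, (a + 2 * b) / 3).
have lt_seq n : (seqI n).1 < (seqI n).2.
  elim: n => [|n] /=; first by lra.
  by rewrite /step; case: ifP => _ /=; lra.
have seqS n : (seqI n).1 <= (seqI n.+1).1 /\ (seqI n.+1).2 <= (seqI n).2.
  by have := lt_seq n; rewrite /= /step; case: ifP => _ /=; split; lra.
have mono n k : (seqI n).1 <= (seqI (n + k)%N).1 /\ (seqI (n + k)%N).2 <= (seqI n).2.
  elim: k => [|k [h1 h2]]; first by rewrite addn0.
  rewrite addnS; have [h3 h4] := seqS (n + k)%N.
  by split; [exact: le_trans h3 | exact: le_trans h2].
have le_seq n k : (seqI n).1 <= (seqI k).2.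
  have [h1 _] := mono n k; have [_ h2] := mono k n.
  rewrite addnC in h2; have := lt_seq (n + k)%N => /ltW h3.
  exact: le_trans (le_trans h1 h3) h2.
pose E (x : R) := exists n, x = (seqI n).1.
have [|| r [ub lub]] := Raxioms.completeness E.
- by exists (seqI 0).2 => x [n ->]; apply/RleP.
- by exists (seqI 0).1, 0.
have lo n : (seqI n).1 <= r by apply/RleP; apply: ub; exists n.
have hi n : r <= (seqI n).2 by apply/RleP; apply: lub => x [k ->]; apply/RleP.
exists r; first by have := lo 0; have := hi 0; rewrite /=; lra.
move=> n; have := lo n.+1; have := hi n.+1; have := lt_seq n; rewrite /= /step.
by case: (ltP (u n)) => h /= h1 h2 h3; apply/eqP => e; lra.
Qed.

(** * Subfamilies of an algebraically independent family *)

Section Reindex.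
Variables (I J : finType) (f : I -> J).
Hypothesis f_inj : injective f.

Let fwd : {mpoly rat[#|I|]} -> {mpoly rat[#|J|]} :=
  mmap (@mpolyC #|J| rat) (fun k => mvar (f (enum_val k))).
Let bwd : {mpoly rat[#|J|]} -> {mpoly rat[#|I|]} :=
  mmap (@mpolyC #|I| rat)
    (fun k => if [pick i | f i == enum_val k] is Some i then mvar i else 0).

(** A relation for [y \o f] becomes one for [y] by renaming variables through [fwd]. No relation is
    lost, since [bwd], which sends the variables outside the image of [f] to 0, undoes the
    renaming. *)
Lemma alg_indep_reindex (y : J -> R) : alg_indep y -> alg_indep (y \o f).
Proof.
move=> hy P hP.
have fwdK : bwd (fwd P) = P.
  rewrite -[RHS]/(idfun P); apply: (@mpoly_rmorph_ext _ _ _ (bwd \o fwd) idfun) => [c|i] /=.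
    by rewrite /fwd mmapC /bwd mmapC.
  rewrite /fwd mmapX mmap1U /bwd mmapX mmap1U enum_rankK.
  case: pickP => [j /eqP /f_inj ->|/(_ (enum_val i))]; last by rewrite eqxx.
  by rewrite /mvar enum_valK.
have -> : P = bwd (fwd P) by [].
suff -> : fwd P = 0 by rewrite /bwd mmap0.
apply: hy; rewrite -[RHS]hP.
apply: (@mpoly_rmorph_ext _ _ _ (mev y \o fwd) (mev (y \o f))) => [c|i] /=.
  by rewrite /fwd mmapC !mevC.
by rewrite /fwd mmapX mmap1U mevX /mev mmapX mmap1U.
Qed.
End Reindex.

(** * Adjoining one number to an algebraically independent family *)

Section OneMore.
Variables (I : finType) (x : I -> R).
Local Notation J := (option I).

(** The variable [None] is singled out as the outer indeterminate; [back] is a left inverse, whence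
    injectivity. *)
Definition poly_in_None : {mpoly rat[#|{: J}|]} -> {poly {mpoly rat[#|I|]}} :=
  mmap (polyC \o @mpolyC #|I| rat)
    (fun k => if enum_val k is Some i then (mvar i)%:P else 'X).

Let back (Q : {poly {mpoly rat[#|I|]}}) : {mpoly rat[#|{: J}|]} :=
  (map_poly (mmap (@mpolyC #|{: J}| rat) (fun k => mvar (Some (enum_val k)))) Q).[mvar None].

Lemma poly_in_None_eq0 P : poly_in_None P = 0 -> P = 0.
Proof.
move=> P0; suff <- : back (poly_in_None P) = P by rewrite P0 /back rmorph0 horner0.
rewrite -[RHS]/(idfun P).
pose g := horner_eval (mvar None : {mpoly rat[#|{: J}|]}) \o
  map_poly (mmap (@mpolyC #|{: J}| rat) (fun k => mvar (Some (enum_val k)))) \o poly_in_None.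
apply: (@mpoly_rmorph_ext _ _ _ g idfun) => [c|i]; rewrite /g /= /poly_in_None.
  by rewrite mmapC /= /horner_eval map_polyC /= hornerC mmapC.
rewrite mmapX mmap1U /horner_eval; case E : (enum_val i) => [j|].
  by rewrite map_polyC /= hornerC mmapX mmap1U enum_rankK -E /mvar enum_valK.
by rewrite map_polyX hornerX -E /mvar enum_valK.
Qed.

Lemma mev_oapp r P : mev (oapp x r) P = (map_poly (mev x) (poly_in_None P)).[r].
Proof.
pose g := horner_eval r \o map_poly (mev x) \o poly_in_None.
rewrite -[RHS]/(g P); apply: (@mpoly_rmorph_ext _ _ _ (mev (oapp x r)) g) => [c|i];
  rewrite /g /= /poly_in_None.
  by rewrite mevC mmapC /= /horner_eval map_polyC /= hornerC mevC.
rewrite {1}/mev !mmapX !mmap1U /horner_eval; case: (enum_val i) => [j|] /=.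
  by rewrite map_polyC /= hornerC mevX.
by rewrite map_polyX hornerX.
Qed.

(** There are countably many rational polynomials. Each nonzero one, with [x] substituted, is a
    nonzero polynomial in the new number, as [x] is independent, and so excludes finitely many
    values. *)
Lemma alg_indep_option (a b : R) : alg_indep x -> a < b ->
  exists2 r, a < r < b & alg_indep (oapp x r).
Proof.
move=> hx ab.
pose poly_of (s : seq (rat * 'X_{1..#|{: J}|})) : {mpoly rat[#|{: J}|]} :=
  \sum_(c <- s) c.1 *: 'X_[c.2].
pose rts P := rootsR (map_poly (mev x) (poly_in_None P)).
(* The integer [n] codes a list of coefficients with monomials and the index of a root; all the
   values to avoid are enumerated this way. *)
pose u n : R := if (unpickle n : option (seq (rat * 'X_{1..#|{: J}|}) * nat)) is Some (s, i)
  then nth 0 (rts (poly_of s)) i else 0.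
have [r hr ur] := real_avoiding_sequence u ab.
exists r => // P hP; apply/eqP/negPn/negP => P0.
have nz : map_poly (mev x) (poly_in_None P) != 0.
  apply: contra_neq P0 => /polyP h0; apply: poly_in_None_eq0; apply/polyP => i.
  by have := h0 i; rewrite coef_map !coef0 => /= /hx.
have rP : r \in rts P.
  by rewrite -roots_on_rootsR // in_itv /= /root -mev_oapp; apply/eqP.
pose s := [seq (P@_m, m) | m <- msupp P].
have sP : poly_of s = P by rewrite /poly_of big_map [RHS]mpolyE.
by have /eqP := ur (pickle (s, index r (rts P))); rewrite /u pickleK sP nth_index.
Qed.
End OneMore.

Lemma alg_indep_extend (I : finType) (J : {set I}) (x : {i | i \in J} -> R) (a b : I -> R) :
  alg_indep x -> (forall i, a i < b i) ->
  exists y : I -> R, [/\ alg_indep y, forall i, y (val i) = x i &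
    forall i, i \notin J -> a i < y i < b i].
Proof.
move=> + hab; have [n] := ubnP #|~: J|; elim: n => // n IH in J x *.
move=> le_n hx; case: (set_0Vmem (~: J)) => [J0|[i0]].
  have JT i : i \in J by have := in_set0 i; rewrite -J0 in_setC => /negbFE.
  exists (fun i => x (exist _ i (JT i))); split.
  - apply: (alg_indep_reindex (f := fun i => exist _ i (JT i)) _ hx).
    by move=> i j [].
  - by move=> i; congr x; apply: val_inj.
  - by move=> i; rewrite JT.
rewrite in_setC => i0J.
have [r hr hxr] := alg_indep_option hx (hab i0).
(* The new index [i0] goes to [None] and the old indices to themselves. *)
pose f (i : {i | i \in i0 |: J}) : option {i | i \in J} := insub (val i).
have f_inj : injective f.
  move=> i j; rewrite /f.
  case: insubP => [i' _ ei|]; case: insubP => [j' _ ej|] //.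
    by move=> [eij]; apply: val_inj; rewrite -ei -ej eij.
  have := valP i; have := valP j; rewrite !in_setU1.
  by move=> /orP[/eqP hj|->//] /orP[/eqP hi|->//] _ _ _; apply: val_inj; rewrite hi hj.
have [||y [hy yx yab]] := IH (i0 |: J) (oapp x r \o f).
- have lt_card : (#|~: (i0 |: J)| < #|~: J|)%N.
    by apply: proper_card; rewrite setCU setIC -setDE properD1 // in_setC.
  exact: leq_trans lt_card le_n.
- exact: alg_indep_reindex.
exists y; split=> // i.
- have iJ' : val i \in i0 |: J by rewrite in_setU1 (valP i) orbT.
  by rewrite -[val i]/(val (exist (fun i => i \in i0 |: J) _ iJ')) yx /= /f /= valK.
- move=> iJ; have [->|ne] := eqVneq i i0; last by apply: yab; rewrite in_setU1 negb_or ne.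
  rewrite -[X in y X]/(val (exist (fun i => i \in i0 |: J) _ (setU11 i0 J))) yx /= /f /=.
  by rewrite insubN.
Qed.

Section GenericFrameworks.
Variables (V : finType) (d : nat) (A : {set V}).

Lemma generic_restrict (p : V -> 'rV[R]_d) :
  generic p -> generic (fun v : {v | v \in A} => p (val v)).
Proof.
move=> gp; pose f (vi : {v | v \in A} * 'I_d) := (val vi.1, vi.2).
apply: (alg_indep_reindex (f := f) _ gp) => -[v i] [w j] [/val_inj -> ->] //.
Qed.

Lemma generic_extend (p : {v | v \in A} -> 'rV[R]_d) (c : V -> 'rV[R]_d) (h : R) :
  generic p -> 0 < h ->
  exists q : V -> 'rV[R]_d, [/\ generic q, forall v, q (val v) = p v &
    forall v, v \notin A -> forall i, `|q v ord0 i - c v ord0 i| < h].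
Proof.
move=> gp h0; pose J := [set vi : V * 'I_d | vi.1 \in A].
have JA (vi : {vi | vi \in J}) : (val vi).1 \in A by have := valP vi; rewrite inE.
pose f (vi : {vi | vi \in J}) : {v | v \in A} * 'I_d :=
  (exist _ (val vi).1 (JA vi), (val vi).2).
have f_inj : injective f.
  move=> vi wj [e1 e2]; apply: val_inj.
  by rewrite [LHS]surjective_pairing [RHS]surjective_pairing; congr pair.
have [||y [hy yx yab]] := @alg_indep_extend _ J (coords p \o f)
    (fun vi => c vi.1 ord0 vi.2 - h) (fun vi => c vi.1 ord0 vi.2 + h).
- exact: alg_indep_reindex.
- by move=> vi; lra.
exists (fun v => \row_i y (v, i)); split.
- rewrite /generic (_ : (fun _ => _) = y) //; apply: functional_extensionality => -[v i].
  by rewrite /= mxE.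
- move=> v; apply/rowP => i; rewrite mxE.
  have vJ : (val v, i) \in J by rewrite inE (valP v).
  rewrite -[(val v, i)]/(val (exist (fun vi => vi \in J) _ vJ)) yx /= /coords /=.
  by congr (p _ _ _); apply: val_inj.
- move=> v vA i; rewrite mxE; have := yab (v, i); rewrite inE => /(_ vA) /=.
  by rewrite ltr_distl.
Qed.
End GenericFrameworks.

(** * Linked pairs and clique sums of frameworks *)

Section Geometry.
Variable d : nat.
Implicit Types x y z a b : 'rV[R]_d.

Definition dot x y : R := \sum_(i < d) x ord0 i * y ord0 i.

Lemma dotC x y : dot x y = dot y x.
Proof. by apply: eq_bigr => i _; rewrite mulrC. Qed.
Lemma dotDl x y z : dot (x + y) z = dot x z + dot y z.
Proof. by rewrite -big_split; apply: eq_bigr => i _; rewrite mxE mulrDl. Qed.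
Lemma dotZl c x z : dot (c *: x) z = c * dot x z.
Proof. by rewrite mulr_sumr; apply: eq_bigr => i _; rewrite mxE mulrA. Qed.
Lemma dotNl x z : dot (- x) z = - dot x z.
Proof. by rewrite -scaleN1r dotZl mulN1r. Qed.
Lemma dotDr x y z : dot z (x + y) = dot z x + dot z y.
Proof. by rewrite dotC dotDl !(dotC _ z). Qed.
Lemma dotZr c x z : dot z (c *: x) = c * dot z x.
Proof. by rewrite dotC dotZl dotC. Qed.
Lemma dotNr x z : dot z (- x) = - dot z x.
Proof. by rewrite dotC dotNl dotC. Qed.
Definition dotE := (dotDl, dotDr, dotZl, dotZr, dotNl, dotNr).

Lemma dot_ge0 x : 0 <= dot x x.
Proof. by apply: sumr_ge0 => i _; rewrite -expr2 sqr_ge0. Qed.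

Lemma sqdistE x y : sqdist x y = dot (x - y) (x - y).
Proof. by apply: eq_bigr => i _; rewrite !mxE expr2. Qed.

Lemma dot_eq0 x : dot x x = 0 -> x = 0.
Proof.
move=> h; apply/rowP => i; rewrite mxE; apply/eqP; rewrite -sqrf_eq0 expr2.
have ge0 (j : 'I_d) : true -> 0 <= x ord0 j * x ord0 j by rewrite -expr2 sqr_ge0.
by apply/eqP; apply: (psumr_eq0P ge0 h).
Qed.

Lemma cauchy_schwarz x y : dot x y ^+ 2 <= dot x x * dot y y.
Proof.
have [x0|nz] := eqVneq (dot x x) 0.
  by rewrite (dot_eq0 x0) -(scale0r 0) !dotZl !mul0r expr0n.
have gt0 : 0 < dot x x by rewrite lt_def nz dot_ge0.
(* This squared norm is [dot x x] times the difference of the two sides. *)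
have h := dot_ge0 (dot x x *: y - dot x y *: x); rewrite !dotE (dotC y x) in h.
rewrite -subr_ge0 -(pmulr_rge0 _ gt0); apply: le_trans h _.
by rewrite le_eqVlt; apply/orP; left; apply/eqP; ring.
Qed.

Lemma dist_triangle x y z : dist x z <= dist x y + dist y z.
Proof.
rewrite -(ler_pXn2r (n := 2)) ?nnegrE ?addr_ge0 ?dist_ge0 // sqr_dist.
have le_dot : dot (x - y) (y - z) <= dist x y * dist y z.
  apply: le_trans (ler_norm _) _.
  rewrite -(ler_pXn2r (n := 2)) ?nnegrE ?mulr_ge0 ?dist_ge0 ?normr_ge0 //.
  by rewrite real_normK ?num_real // exprMn !sqr_dist !sqdistE cauchy_schwarz.
rewrite sqrrD !sqr_dist !sqdistE (_ : x - z = (x - y) + (y - z)); last first.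
  by rewrite addrA subrK.
rewrite (dotDl (x - y) (y - z)) !(dotDr (x - y) (y - z)) (dotC (y - z) (x - y)).
by rewrite -mulr_natr; lra.
Qed.

Lemma distC x y : dist x y = dist y x.
Proof. by apply/dist_eq; apply: eq_bigr => i _; rewrite -sqrrN opprB. Qed.

Lemma distxx x : dist x x = 0.
Proof. by rewrite /dist /sqdist big1 ?sqrtr0 // => i _; rewrite subrr expr0n. Qed.

(* The reflection in the bisector hyperplane of [a] and [b]. *)
Lemma bisector_reflection a b : a != b ->
  exists f : 'rV[R]_d -> 'rV[R]_d,
    [/\ forall x y, sqdist (f x) (f y) = sqdist x y, f a = b &
        forall y, sqdist y a = sqdist y b -> f y = y].
Proof.
rewrite -subr_eq0; move En : (a - b : 'rV[R]_d) => n n0.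
have nn : dot n n != 0 by apply: contra_neq n0 => /dot_eq0.
have nE i : n ord0 i = a ord0 i - b ord0 i by rewrite -En !mxE.
pose f x := x - (2 * dot (x - 2^-1 *: (a + b)) n / dot n n) *: n.
exists f; split.
- move=> x y; rewrite !sqdistE.
  have -> : f x - f y = (x - y) - (2 * dot (x - y) n / dot n n) *: n.
    by apply/rowP => i; rewrite /f !dotE !mxE; field; exact: nn.
  rewrite (dotDl (x - y)) !(dotDr (x - y)) !dotNl !dotNr !dotZl !dotZr (dotC n).
  by field; exact: nn.
- apply/rowP => i; rewrite /f.
  have -> : a - 2^-1 *: (a + b) = 2^-1 *: n.
    by apply/rowP => j; rewrite !mxE nE; field.
  by rewrite dotZl !mxE nE; field; exact: nn.
- move=> y; rewrite !sqdistE /f => h.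
  suff -> : dot (y - 2^-1 *: (a + b)) n = 0 by rewrite mulr0 mul0r scale0r subr0.
  move: h; rewrite -En !dotE !(dotC _ y) (dotC b a); lra.
Qed.

(** Points are matched one at a time. If [f (p u)] is not [q u], reflect in their bisector: the
    points already matched are equidistant from both, hence fixed. *)
Lemma isometry_extend (T : eqType) (s : seq T) (p q : T -> 'rV[R]_d) :
  {in s &, forall u v, sqdist (p u) (p v) = sqdist (q u) (q v)} ->
  exists f : 'rV[R]_d -> 'rV[R]_d,
    (forall x y, sqdist (f x) (f y) = sqdist x y) /\ {in s, forall u, f (p u) = q u}.
Proof.
elim: s => [|u s IH] h; first by exists id.
have [|f [fi fs]] := IH.
  by move=> v w vs ws; apply: h; rewrite in_cons ?vs ?ws orbT.
have [e|ne] := eqVneq (f (p u)) (q u).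
  by exists f; split=> // v; rewrite in_cons => /orP[/eqP ->|/fs].
have [g [gi gu gfix]] := bisector_reflection ne.
exists (g \o f); split=> [x y|v] /=; first by rewrite gi.
rewrite in_cons => /orP[/eqP -> //|vs]; rewrite fs // gfix //.
rewrite -{1}(fs _ vs) fi; apply: h; rewrite in_cons ?vs ?eqxx ?orbT //.
Qed.

End Geometry.

(** Applied to differences from an actual distance, this turns finiteness of the possible distances
    into isolation of the actual one. *)
Lemma seq_gap (L : seq R) : exists2 dl : R, 0 < dl &
  {in L, forall l, l != 0 -> dl <= `|l|}.
Proof.
elim: L => [|l L [dl dl0 h]]; first by exists 1.
have [->|l0] := eqVneq l 0.
  by exists dl => // k; rewrite in_cons => /orP[/eqP ->|/h //]; rewrite eqxx.
exists (Num.min dl `|l|) => [|k]; first by rewrite lt_min dl0 normr_gt0.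
rewrite in_cons => /orP[/eqP -> _|/h hk /hk k0]; first by rewrite ge_min lexx orbT.
by rewrite ge_min k0.
Qed.

(** * Linked pairs, parts of a clique sum, connectedness *)

Section Frameworks.
Variables (V : finType) (e : rel V) (d : nat).
Hypothesis e_sym : symmetric e.

Lemma equivalent_induced (A : {set V}) (p0 : {v | v \in A} -> 'rV[R]_d) p q :
  (forall v, p (val v) = p0 v) -> equivalent e p q ->
  equivalent (induced e A) p0 (fun v => q (val v)).
Proof. by move=> pp eq_pq u v uv; rewrite -!pp; apply: eq_pq. Qed.

Lemma dist_path (q : V -> 'rV[R]_d) (h : R) c s : 0 <= h ->
  path (fun a b => dist (q a) (q b) <= h) c s ->
  dist (q c) (q (last c s)) <= (size s)%:R * h.
Proof.
move=> h0; elim: s c => [|a s IH] c /=; first by rewrite distxx mul0r.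
move=> /andP[ca /IH le_s]; apply: le_trans (dist_triangle _ (q a) _) _.
by rewrite -natr1 mulrDl mul1r addrC lerD.
Qed.

Lemma weakly_globally_linked_through_outside (A : {set V}) (x y : {v | v \in A}) c s :
  rigid_graph (induced e A) d -> e (val x) c -> path e c s ->
  all (fun v => v \notin A) (c :: s) -> e (last c s) (val y) ->
  weakly_globally_linked e d (val x) (val y).
Proof.
move=> rigA xc pcs out ly; have [p0 gp0 _] := rigA.
have [L hL] := rigid_graph_finite_dist x y rigA gp0.
set D := dist (p0 x) (p0 y).
have [dl dl0 gap] := seq_gap [seq l - D | l <- L].
pose k : R := (size s)%:R.
have k0 : 0 <= k by exact: ler0n.
have den0 : 0 < 2 * (k + 1) * d.+1%:R :> R.
  by rewrite !mulr_gt0 ?ltr0n //; lra.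
(* Outside vertices lie within [r] of [x]. In an equivalent framework the edge from [x] to [c] has
   length at most [r], each of the [k] path edges at most [2 * r], and the length of the last edge
   differs from [D] by at most [r]. The total error [2 * (k + 1) * r] has to stay below the gap
   [dl]. *)
pose h := dl / (2 * (k + 1) * d.+1%:R).
have h0 : 0 < h by rewrite divr_gt0.
pose r := d%:R * h.
have r0 : 0 <= r by rewrite mulr_ge0 ?ler0n // ltW.
have r_small : 2 * (k + 1) * r < dl.
  have -> : dl = 2 * (k + 1) * r + 2 * (k + 1) * h.
    rewrite -[LHS](divfK (lt0r_neq0 den0)) -/h /r -natr1; ring.
  by rewrite ltrDl; apply: mulr_gt0 => //; lra.
have [p [gp pp near]] := generic_extend (fun _ => p0 x) gp0 h0.
have near_x v : v \notin A -> dist (p v) (p (val x)) <= r.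
  move=> vA; rewrite pp; apply: dist_le_coord; first exact: ltW.
  by move=> i; apply/ltW/near.
have near2 u v : u \notin A -> v \notin A -> dist (p u) (p v) <= 2 * r.
  move=> uA vA; have := dist_triangle (p u) (p (val x)) (p v).
  have := near_x _ uA; have := near_x _ vA; rewrite (distC (p v)); lra.
exists p => // q eq_pq; set Dq := dist (q (val x)) _.
have [cA sA] : c \notin A /\ all (fun v => v \notin A) s by apply/andP.
have lA : last c s \notin A by apply: (allP out); apply: mem_last.
have qcl : dist (q c) (q (last c s)) <= k * (2 * r).
  apply: dist_path; first by lra.
  elim: (s) (c) pcs cA sA => //= b t IH a /andP[ab pbt] aA /andP[bA tA].
  by rewrite IH // andbT -(eq_pq _ _ ab) near2.
have qxc : dist (q (val x)) (q c) <= r.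
  by rewrite -(eq_pq _ _ xc) distC near_x.
have ply := eq_pq _ _ ly.
have Dpp : D = dist (p (val x)) (p (val y)) by rewrite /D !pp.
have close : `|Dq - D| < dl.
  have t1 := dist_triangle (q (val x)) (q c) (q (val y)).
  have t2 := dist_triangle (q c) (q (last c s)) (q (val y)).
  have t3 := dist_triangle (p (last c s)) (p (val x)) (p (val y)).
  have t4 := dist_triangle (q (last c s)) (q (val x)) (q (val y)).
  have t5 := dist_triangle (q (last c s)) (q c) (q (val x)).
  have t6 := dist_triangle (p (val x)) (p (last c s)) (p (val y)).
  have lx := near_x _ lA.
  rewrite (distC (q (last c s)) (q c)) (distC (q c) (q (val x))) in t5.
  rewrite (distC (p (val x)) (p (last c s))) in t6.
  move: (k * r) (mulrA k 2 r) => kr kr2.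
  rewrite ltr_norml; apply/andP; split; rewrite /Dq; lra.
have DqL : Dq \in L.
  by apply: (hL (fun v => q (val v))); apply: equivalent_induced eq_pq.
rewrite -Dpp; apply/eqP/negPn/negP; rewrite -subr_eq0 => ne.
have := gap (Dq - D) (map_f (fun l => l - D) DqL) ne.
by rewrite leNgt close.
Qed.

(* Frameworks on [A] extend along an isometry that matches the clique. *)
Lemma rigid_clique_sum_part (A B : {set V}) :
  A :|: B = [set: V] ->
  (forall x y, x \in A :&: B -> y \in A :&: B -> x != y -> e x y) ->
  (forall x y, x \in A :\: B -> y \in B :\: A -> ~~ e x y) ->
  rigid_graph e d -> rigid_graph (induced e A) d.
Proof.
move=> AB clique nocross rig; have [p gp _] := rig.
exists (fun v => p (val v)); first exact: generic_restrict.
have fin (uv : {v | v \in A} * {v | v \in A}) : exists L : seq R,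
    forall q, equivalent e p q -> dist (q (val uv.1)) (q (val uv.2)) \in L.
  exact: rigid_graph_finite_dist.
have [L {}fin] := fin_all_exists fin.
pose D (uv : {v | v \in A} * {v | v \in A}) := dist (p (val uv.1)) (p (val uv.2)).
have [dl dl0 gap] := seq_gap (flatten [seq [seq l - D uv | l <- L uv] | uv : _]).
(* Moving both ends by less than [dl / 2] changes a distance by less than [dl], the common gap for
   all pairs in [A]. *)
exists (dl / 2) => [|qA eqA near u v]; first by rewrite divr_gt0.
pose S := [seq v <- enum {: {v | v \in A}} | val v \in B].
have [|f [fi fS]] := @isometry_extend _ _ S (fun v => p (val v)) qA.
  move=> a b; rewrite !mem_filter => /andP[aB _] /andP[bB _].
  have [->|ab] := eqVneq a b.
    by rewrite !sqdistE !subrr -(scale0r 0) !dotZl !mul0r.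
  apply/dist_eq/eqA/clique; rewrite ?in_setI ?(valP a) ?(valP b) //.
(* On [A] this is [qA], elsewhere the image of [p] under the isometry; both agree on the clique. *)
pose q v := oapp qA (f (p v)) (insub v).
have qA_val a : q (val a) = qA a by rewrite /q valK.
have qB v0 : v0 \in B -> q v0 = f (p v0).
  rewrite /q; case: insubP => //= a aA <- aB; rewrite -fS //.
  by rewrite mem_filter aB mem_enum.
have eq_pq : equivalent e p q.
  move=> a b ab; have [/andP[aA bA]|nA] := boolP ((a \in A) && (b \in A)).
    have := eqA (exist _ a aA) (exist _ b bA) ab.
    by rewrite -!qA_val.
  have inAB v0 : (v0 \in A) || (v0 \in B) by rewrite -in_setU AB in_setT.
  (* An edge not contained in [A] lies in [B], as no edge joins [A :\: B] to [B :\: A]. *)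
  have [aB bB] : a \in B /\ b \in B.
    have := inAB a; have := inAB b.
    have := nocross a b; have := nocross b a; rewrite !in_setD e_sym ab.
    case: (a \in A) (b \in A) (a \in B) (b \in B) nA => [] [] [] [] //= _.
    - by move=> _ /(_ isT isT).
    - by move=> /(_ isT isT).
  by rewrite !qB //; apply/dist_eq; rewrite fi.
have inL := fin (u, v) _ eq_pq; rewrite /= !qA_val in inL.
apply/esym/eqP/negPn/negP; rewrite -subr_eq0 => ne.
have := gap (dist (qA u) (qA v) - D (u, v)) _ ne; rewrite leNgt => /(_ _)/negP; apply.
  apply/flattenP; exists [seq l - D (u, v) | l <- L (u, v)]; last exact: map_f.
  by apply: image_f.
have nu := near u; have nv := near v.
have t1 := dist_triangle (qA u) (p (val u)) (qA v).
have t2 := dist_triangle (p (val u)) (p (val v)) (qA v).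
have t3 := dist_triangle (p (val u)) (qA u) (p (val v)).
have t4 := dist_triangle (qA u) (qA v) (p (val v)).
rewrite (distC (qA u) (p (val u))) in t1; rewrite (distC (qA v)) in t4.
by rewrite /D /= ltr_norml; apply/andP; split; lra.
Qed.

(** A generic realization witnessing a link in the induced subgraph extends to a generic realization
    of the whole graph, here with the other vertices near the origin, and still witnesses the
    link. *)
Lemma totally_loose_induced (A : {set V}) :
  totally_loose e d -> totally_loose (induced e A) d.
Proof.
move=> tl u v uv nuv [p0 gp0 wgl]; apply: (tl (val u) (val v)) => //.
have [p [gp pp _]] := generic_extend (fun _ => 0) gp0 ltr01.
exists p => // q eq_pq; rewrite !pp.
by apply: (wgl (fun v => q (val v))); apply: equivalent_induced eq_pq.
Qed.

(** If no edge left [C], a small translation of [C] would preserve all edge lengths but change the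
    distance from [w] to [u]. *)
Lemma rigid_graph_connected (C : {set V}) w u : (0 < d)%N ->
  rigid_graph e d -> w \in C -> u \notin C ->
  exists a b, [/\ a \in C, b \notin C & e a b].
Proof.
move=> d0 [p _ [eps eps0 rig]] wC uC; apply: NNPP => none.
pose i0 := Ordinal d0.
pose z := p w ord0 i0 - p u ord0 i0.
(* Translation by [t] along the first axis changes the squared distance by [t * (2 * z + t)]; one of
   [eps / 2] and [eps / 4] makes this nonzero. *)
have [t [t0 teps tz]] : exists t : R, [/\ 0 < t, t < eps & 2 * z + t != 0].
  have [h|h] := eqVneq (2 * z + eps / 2) 0.
    by exists (eps / 4); split; [lra | lra | apply/eqP; lra].
  by exists (eps / 2); split; [lra | lra |].
pose s : 'rV[R]_d := t *: delta_mx ord0 i0.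
pose q v := if v \in C then p v + s else p v.
have dot_s x : dot x s = t * x ord0 i0.
  rewrite /dot (bigD1 i0) //= big1 ?addr0 => [|i /negPf ni].
    by rewrite !mxE !eqxx mulr1 mulrC.
  by rewrite !mxE eqxx ni !mulr0.
have eq_pq : equivalent e p q.
  move=> a b ab; apply/dist_eq; rewrite /q !sqdistE.
  have same : (a \in C) = (b \in C).
    apply/idP/idP => h; apply/negPn/negP => h'; apply: none.
    - by exists a, b.
    - by exists b, a; rewrite e_sym.
  rewrite same; case: (b \in C) => //.
  by rewrite opprD addrACA subrr addr0.
have near : forall v, dist (p v) (q v) < eps.
  move=> v; rewrite /q; case: (v \in C); last by rewrite distxx.
  rewrite -(ltr_pXn2r (n := 2)) ?nnegrE ?dist_ge0 ?(ltW eps0) // sqr_dist sqdistE.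
  rewrite opprD addrA subrr add0r dotNl dotNr opprK dot_s !mxE !eqxx mulr1 -expr2.
  by rewrite ltr_pXn2r ?nnegrE ?ltW.
have /dist_eq := rig q eq_pq near w u; rewrite /q wC (negPf uC) !sqdistE.
rewrite addrAC (dotDl (_ - _)) !(dotDr (_ - _)) (dotC s) !dot_s !mxE !eqxx mulr1.
rewrite -/z => h; move/eqP: tz; apply.
have : t * (2 * z + t) = 0 by lra.
by move/eqP; rewrite mulf_eq0 (gt_eqF t0) => /eqP.
Qed.
End Frameworks.

(** * Decomposition along an outside component *)

Section OutsideComponent.
Variables (V : finType) (e : rel V) (A : {set V}) (w : V).
Hypotheses (e_sym : symmetric e) (wA : w \notin A).

Definition outside_adj : rel V := [rel a b | [&& e a b, a \notin A & b \notin A]].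
Definition outside_component : {set V} := [set z | connect outside_adj w z].
Definition attachment : {set V} :=
  [set a in A | [exists z in outside_component, e a z]].

Local Notation C := outside_component.
Local Notation N := attachment.

Lemma outside_adj_sym : connect_sym outside_adj.
Proof.
apply: sym_connect_sym => a b; rewrite /outside_adj /= e_sym.
by congr (_ && _); rewrite andbC.
Qed.

Lemma outside_path c s : c \notin A -> path outside_adj c s ->
  path e c s && all (fun v => v \notin A) (c :: s).
Proof.
elim: s c => [|b s IH] c cA /=; first by rewrite cA.
move=> /andP[/and3P[-> _ bA] /(IH _ bA) /andP[-> /= ->]].
by rewrite cA.
Qed.

Lemma outside_componentP z : z \in C -> z \notin A.
Proof.
rewrite inE => /connectP[s /(outside_path wA) /andP[_ /allP out] ->].
by apply: out; apply: mem_last.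
Qed.

Lemma outside_component_step a b : a \in C -> e a b -> b \notin A -> b \in C.
Proof.
move=> aC ab bA; have aA := outside_componentP aC.
move: aC; rewrite !inE => /connect_trans; apply; apply: connect1.
by rewrite /outside_adj /= ab aA bA.
Qed.

Lemma outside_component_self : w \in C.
Proof. by rewrite inE connect0. Qed.

(** The two sides of the clique sum will be [~: C] and [C :|: N]. *)
Lemma attachmentI : ~: C :&: (C :|: N) = N.
Proof.
apply/setP => z; rewrite in_setI in_setC in_setU.
case: (boolP (z \in C)) => [/outside_componentP zA|] //=.
by rewrite inE (negPf zA).
Qed.

Lemma attachment_nocross x y : x \in ~: C :\: (C :|: N) -> y \in (C :|: N) :\: ~: C -> ~~ e x y.
Proof.
rewrite !in_setD !in_setC !in_setU negb_or negbK.
move=> /andP[/andP[_ xN] xC] /andP[yC _]; apply/negP => xy.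
case: (boolP (x \in A)) => xA.
  by move: xN; rewrite inE xA /= => /negP; apply; apply/existsP; exists y; rewrite yC.
by move: xC; rewrite (outside_component_step yC) // e_sym.
Qed.

(** Neighbours of [x] and [y] in [C] are joined by a path outside [A], so a nonadjacent pair would
    be weakly globally linked. *)
Lemma attachment_clique d x y : rigid_graph (induced e A) d -> totally_loose e d ->
  x \in N -> y \in N -> x != y -> e x y.
Proof.
move=> rigA tl; rewrite !inE => /andP[xA /existsP[c /andP[cC xc]]].
move=> /andP[yA /existsP[c' /andP[c'C yc']]] xy; apply/negPn/negP => nxy.
have cA := outside_componentP cC.
have : connect outside_adj c c'.
  by move: cC c'C; rewrite !inE outside_adj_sym => /connect_trans; apply.
move=> /connectP[s /(outside_path cA)/andP[pcs out] ec'].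
apply: (tl x y xy nxy).
apply: (weakly_globally_linked_through_outside
  (x := exist _ x xA) (y := exist _ y yA) rigA xc pcs out).
by rewrite -ec' e_sym.
Qed.

End OutsideComponent.

(** * Induction on the number of vertices *)

Lemma clique_sum_of_special_card (d n : nat) (V : finType) (e : rel V) :
  (#|V| < n)%N -> (0 < d)%N -> symmetric e ->
  rigid_graph e d -> totally_loose e d -> clique_sum_of_special d e.
Proof.
elim: n V e => // n IH V e le_n d0 e_sym rig tl.
have [|nsp] := classic (special d e); first exact: cs_special.
have [A [AT rigA [u [v [uv nuv]]]]] : exists A : {set V},
    [/\ A != [set: V], rigid_graph (induced e A) d &
        exists u v : {x | x \in A}, u != v /\ ~~ induced e A u v].
  apply: NNPP => none; apply: nsp; split=> // A AT rigA u v uv.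
  by apply/negPn/negP => nuv; apply: none; exists A; split=> //; exists u, v.
have [w _ wA] : exists2 w, w \in [set: V] & w \notin A.
  by apply/subsetPn; apply: contraNN AT; rewrite subTset.
pose C := outside_component e A w; pose N := attachment e A w.
have wC : w \in C := outside_component_self e A w.
have AC z : z \in A -> z \notin C.
  by move=> zA; apply: contraTN zA; apply: outside_componentP.
have cl x y : x \in N -> y \in N -> x != y -> e x y by exact: attachment_clique tl.
have cover : ~: C :|: (C :|: N) = [set: V]
  by apply/setP => z; rewrite !in_setU in_setC in_setT; case: (z \in C).
have nocross : forall x y, x \in ~: C :\: (C :|: N) -> y \in (C :|: N) :\: ~: C -> ~~ e x y.
  exact: attachment_nocross.
have part (S : {set V}) : S != [set: V] -> rigid_graph (induced e S) d ->
    clique_sum_of_special d (induced e S).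
  move=> ST rigS; apply: IH => //.
  - rewrite card_sig; rewrite ltnS in le_n; apply: leq_trans le_n; rewrite -cardsT.
    by apply: proper_card; rewrite properEneq ST subsetT.
  - by move=> x y; apply: e_sym.
  - exact: totally_loose_induced.
have NI : ~: C :&: (C :|: N) = N by exact: attachmentI.
apply: (cs_sum cover _ _ nocross); rewrite ?NI //.
(* Connectedness yields an edge leaving [C]; its outer end lies in [A], hence in [N], so the overlap
   is nonempty. *)
- have [a [b [aC bC ab]]] := rigid_graph_connected e_sym d0 rig wC (AC _ (valP u)).
  apply/card_gt0P; exists b; rewrite inE; apply/andP; split.
    by apply: contraNT bC => bA; apply: outside_component_step ab bA.
  by apply/existsP; exists a; rewrite aC e_sym.
- apply: part.
    by apply/negP => /eqP /setP/(_ w); rewrite in_setC wC in_setT.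
  by apply: (rigid_clique_sum_part e_sym cover) => // x y; rewrite NI; apply: cl.
- apply: part.
    (* If this part were everything, all of [A] would lie in the clique [N], against the nonadjacent
       pair [u], [v]. *)
    apply/negP => /eqP ST; have inN (z : {x | x \in A}) : val z \in N.
      by have := in_setT (val z); rewrite -ST in_setU (negPf (AC _ (valP z))).
    by move: nuv; rewrite /induced cl ?inN.
  apply: (@rigid_clique_sum_part _ _ _ e_sym _ (~: C)) rig => [|x y|x y xB yA].
  + by rewrite setUC.
  + by rewrite setIC NI; apply: cl.
  + by rewrite e_sym; apply: nocross.
Qed.

Theorem theorem4p3 (d : nat) (V : finType) (e : rel V) :
  (1 <= d)%N -> symmetric e -> irreflexive e ->
  rigid_graph e d -> totally_loose e d ->
  clique_sum_of_special d e.
Proof. by move=> d1 e_sym _; apply: (clique_sum_of_special_card (ltnSn _)). Qed.
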